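(* Let $C_n=\frac{1}{n+1}\binom{2n}{n}$ ($n\ge0$) denote the Catalan numbers, and let $S_n(\gamma,\delta)$ be the moments defined in the context. i) For all $n\ge 0$, $$\sum_{i=0}^{\lfloor n/2\rfloor}\binom{n}{2i}2^{n-2i}\binom{2i}{i}=\binom{2n}{n}.$$ ii) For all $n\ge 1$, $$\binom{2n}{n}=2\cdot 4^{n-1}-2^{n-1}\sum_{j=1}^{\lfloor n/2\rfloor}\binom{n}{2j}\sum_{s=0}^{j-1}\frac{C_s}{4^s}.$$ iii) For all $n\ge 0$, $$C_{n+1}=2\binom{2n}{n}-\frac12\sum_{j=0}^{\lfloor n/2\rfloor}\binom{n}{2j}2^{n-2j}\binom{2j+2}{j+1}.$$ iv) For all $n\ge 0$, $$C_n=\sum_{k=0}^{n}(-1)^k\binom{n}{k}\binom{k}{\lfloor k/2\rfloor}2^{n-k}.$$ v) For all $n\ge 0$, $$\frac{1}{2^{n-1}}\binom{n}{\lfloor n/2\rfloor}=2-\sum_{j=0}^{\lfloor (n-1)/2\rfloor}\frac{1}{4^j}C_j.$$ vi) For all $n\ge 0$, $$S_n(3/2,3/2)=2\binom{n}{\lfloor n/2\rfloor}-\binom{n+1}{\lfloor (n+1)/2\rfloor}.$$ vii) Put $C_{-1}=-1/2$, $d_0=1$ and, for $n\ge 0$, $$d_n=\frac{n!}{2\cdot 4^{n-1}}\sum_{k=0}^{n}(-1)^{k-1}\binom{2k}{k}C_{n-k-1}$$ (for $n=0$ this formula also gives $1$). Then for all $n\ge 0$ $$S_n(1,2)=\frac{\pi}{4}\sum_{k\ge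 0}\frac{S_{n+k}(3/2,3/2)}{2^k k!}d_k .$$ In particular, for all $j\ge 0$, $$\frac{-2\cdot 2^{2j}}{2j+3}=\frac{\pi}{4}\sum_{k\ge 0}\frac{C_{j+k+1}}{2^{2k+1}(2k+1)!}d_{2k+1},\qquad \frac{4^j}{2j+1}=\frac{\pi}{4}\sum_{k\ge 0}\frac{C_{j+k}}{4^k(2k)!}d_{2k}.$$
   Context: For $\gamma,\delta>0$ and integer $n\ge 0$, $$S_n(\gamma,\delta)=\int_{-2}^{2}x^n\,\frac{(x+2)^{\gamma-1}(2-x)^{\delta-1}}{4^{\gamma+\delta-1}B(\gamma,\delta)}\,dx,$$ where $B$ is the Beta function. Empty sums equal $0$. *)

(* Defs.v *)
(* MathComp-Analysis, over an abstract R : realType. *)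
From HB Require Import structures.
From mathcomp Require Export all_boot all_order all_algebra.
From mathcomp Require Export all_classical all_reals all_analysis.

Set Implicit Arguments.
Unset Strict Implicit.
Unset Printing Implicit Defensive.

Export Order.TTheory GRing.Theory Num.Theory.
Export numFieldNormedType.Exports.

Local Open Scope classical_set_scope.
Local Open Scope ring_scope.

(* The library's beta_fun only takes natural parameters. *)
Definition euler_beta (R : realType) (a b : R) : R :=
  \int[lebesgue_measure]_(t in `[0, 1]) (t `^ (a - 1) * (1 - t) `^ (b - 1)).

(* Meaningful for c, d > 0. At the endpoints powR takes the values 0 `^ 0 = 1
   and 0 `^ r = 0 for r != 0, which only matters on a null set. *)
Definition moment (R : realType) (c d : R) (n : nat) : R :=
  \int[lebesgue_measure]_(x in `[-2, 2])
    (x ^+ n * (((x + 2) `^ (c - 1) * (2 - x) `^ (d - 1))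
               / (4 `^ (c + d - 1) * euler_beta c d))).

Definition catalan (R : realType) (n : nat) : R :=
  n.+1%:R^-1 * 'C(2 * n, n)%:R.

(* Extension by C_(-1) = -1/2; indices below -1 never occur and get 0. *)
Definition catalanz (R : realType) (m : int) : R :=
  match m with
  | Posz n => catalan R n
  | Negz 0 => - (1 / 2)
  | Negz _ => 0
  end.

(* Exponents n - 1 and k - 1 are integers: both can be -1. *)
Definition dcoef (R : realType) (n : nat) : R :=
  n`!%:R / (2 * 4 ^ (n%:Z - 1)) *
  \sum_(0 <= k < n.+1)
     (-1) ^ (k%:Z - 1) * 'C(2 * k, k)%:R * catalanz R (n%:Z - k%:Z - 1).

(* Main.v *)
Require Import Defs.
From mathcomp Require Import zify ring lra.

(** Write b_k for the central binomial coefficient C(2k, k) and C_k for the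
Catalan numbers.

Identities i, iii and iv are one coefficient extraction.  The polynomial
2X + b(1 + X^2) is (1 + X)^2 for b = 1 and -(1 - X)^2 for b = -1.  Expanding
the n-th power of the sum binomially, multiplying by a polynomial A and reading
off the coefficient of X^n gives [coef_trinomial]; the choices A = 1, 1 + X^2
and 1 + X make the coefficient of X^k in A (1 + X^2)^k equal to the
binomial coefficients of i, iii and iv.  The other sides come out as
C_n = C(2n, n) - C(2n, n+1) and C_(n+1) = C(2n, n) - C(2n, n+2).  Identity v
telescopes, because 2 b_j / 4^j decreases by C_j / 4^j when j grows by one; ii
is i with b_j rewritten through v.

For vi, the law with parameters (3/2, 3/2) is the semicircle law.  The
derivative of x^(n+1) (1 - x^2)^(3/2) relates the moments of orders n and n + 2
by the recurrence of the Catalan numbers, and the arcsine gives the total mass.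

For vii, put y = x/2.  The density of the law with parameters (1, 2) is
(pi/4) sqrt((1 - y) / (1 + y)) times the semicircle density, and d_k / k! is the
k-th Taylor coefficient of sqrt((1 - y) / (1 + y)).  This function is also
(1 - y) / sqrt(1 - y^2), so d_2k / (2k)! = b_k / 4^k, and d_(2k+1) / (2k+1)! is
the opposite number ([dcoef_even], [dcoef_odd]).  As the odd semicircle moments
vanish, every series of vii becomes, up to a factor, the sum over k of
C_(j+k) b_k / 16^k.  No exchange of sum and integral is involved: the partial
sums of this hypergeometric series telescope
([catalan_central_binomial_series]), and their limit is Wallis' formula
N b_N^2 / 16^N -> 1/pi.  The latter is obtained by squeezing consecutive moments
of the half semicircle, on [0, 1], between each other ([wallis_dist_le]). *)

Local Open Scope classical_set_scope.
Local Open Scope ring_scope.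

(** * Coefficient extraction *)

Lemma sum_even_terms (V : nmodType) (f : nat -> V) (m : nat) :
  (forall i, f (2 * i).+1%N = 0) ->
  \sum_(0 <= k < m) f k = \sum_(0 <= i < uphalf m) f (2 * i)%N.
Proof.
move=> f0; elim: m => [|m IHm]; first by rewrite !big_geq.
rewrite big_nat_recr//= IHm uphalfE.
have [om|em] := boolP (odd m).
- have -> : f m = 0 by rewrite -(f0 m./2); congr f; lia.
  by rewrite addr0; congr (bigop _ _ _); rewrite /index_iota; congr iota; lia.
- have -> : m.+1./2 = m./2 by lia.
  by rewrite big_nat_recr//=; congr (_ + f _); lia.
Qed.

Lemma coef_exp_1DXn (R : comNzRingType) (c : R) (d k m : nat) : (0 < d)%N ->
  ((1 + c *: 'X^d) ^+ k)`_m =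
  if (d %| m)%N then c ^+ (m %/ d) * 'C(k, m %/ d)%:R else 0.
Proof.
move=> d0; rewrite exprDn coef_sum.
under eq_bigr => i _ do
  rewrite expr1n mul1r exprZn -exprM coefMn coefZ coefXn.
case: ifPn => [/dvdnP[q ->]|dNm]; last first.
  rewrite big1// => i _; have [E|] := eqVneq m (d * i)%N.
    by rewrite E dvdn_mulr in dNm.
  by rewrite mulr0 mul0rn.
rewrite mulnK// mulnC.
have [qk|kq] := leqP q k.
  rewrite (bigD1 (Ordinal (qk : (q < k.+1)%N)))//= eqxx mulr1 big1 ?addr0 ?mulr_natr//.
  move=> i; rewrite -val_eqE/= => iq.
  by rewrite eqn_pmul2l// eq_sym (negbTE iq) mulr0 mul0rn.
rewrite bin_small// mulr0 big1// => i _.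
rewrite eqn_pmul2l//; case: eqP => [E|]; last by rewrite mulr0 mul0rn.
by have := ltn_ord i; rewrite -E; lia.
Qed.

(** Every summand X^(n-k) (1 + X^2)^k of the binomial expansion shifts the index
by n - k, whence the coefficient of index k on the right.  The scalar 1 in
front of X^2 is kept in order that [coef_exp_1DXn] applies. *)
Lemma coef_trinomial (R : comNzRingType) (A : {poly R}) (b : R) (n : nat) :
  (A * (2%:R *: 'X + b *: (1 + 1 *: 'X^2)) ^+ n)`_n =
  \sum_(0 <= k < n.+1)
     'C(n, k)%:R * 2%:R ^+ (n - k) * b ^+ k * (A * (1 + 1 *: 'X^2) ^+ k)`_k.
Proof.
rewrite exprDn mulr_sumr coef_sum big_mkord; apply: eq_bigr => i _.
rewrite mulrnAr coefMn !exprZn -scalerAl -!scalerAr scalerA coefZ mulrCA coefXnM.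
rewrite ltnNge leq_subr/= subKn; last by rewrite -ltnS.
by rewrite -[LHS]mulr_natl !mulrA.
Qed.

Lemma central_binomial_sum (R : comNzRingType) (n : nat) :
  \sum_(0 <= i < n./2.+1)
     'C(n, 2 * i)%:R * 2 ^+ (n - 2 * i) * 'C(2 * i, i)%:R
  = 'C(2 * n, n)%:R :> R.
Proof.
have := @coef_trinomial R 1 1 n.
rewrite (_ : 2%:R *: 'X + _ = (1 + 1 *: 'X^1) ^+ 2); last first.
  by rewrite !scale1r expr1 scaler_nat -mulr_natl; ring.
rewrite mul1r -exprM coef_exp_1DXn// divn1 expr1n dvd1n mul1r => ->; symmetry.
rewrite sum_even_terms; last first.
  by move=> i; rewrite mul1r coef_exp_1DXn// ifN ?mulr0//; lia.
symmetry; apply: eq_bigr => i _.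
by rewrite mul1r coef_exp_1DXn// dvdn_mulr// mulKn// !expr1n mulr1 mul1r.
Qed.

(** The factor 1 + X^2 turns C(2j, j) into C(2j+1, j), and on the other side
adds the coefficient of X^(n-2) in (1 + X)^(2n). *)
Lemma next_central_binomial_sum (R : comNzRingType) (n : nat) :
  \sum_(0 <= j < n./2.+1)
     'C(n, 2 * j)%:R * 2 ^+ (n - 2 * j) * 'C((2 * j).+1, j)%:R
  = 'C(2 * n, n)%:R + 'C(2 * n, n.+2)%:R :> R.
Proof.
have := @coef_trinomial R (1 + 'X^2) 1 n.
rewrite (_ : 2%:R *: 'X + _ = (1 + 1 *: 'X^1) ^+ 2); last first.
  by rewrite !scale1r expr1 scaler_nat -mulr_natl; ring.
rewrite -exprM mulrDl mul1r coefD coefXnM.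
rewrite !coef_exp_1DXn// !divn1 !expr1n !dvd1n !mul1r.
rewrite (_ : (if _ then _ else _) = 'C(2 * n, n.+2)%:R); last first.
  case: ifPn => [n2|n2]; first by rewrite bin_small//; lia.
  rewrite (_ : n - 2 = 2 * n - n.+2)%N; last by lia.
  by rewrite bin_sub//; lia.
move=> ->; symmetry; rewrite sum_even_terms; last first.
  move=> i; rewrite -{1}['X^2]scale1r -exprS coef_exp_1DXn// ifN ?mulr0//; lia.
symmetry; apply: eq_bigr => i _.
rewrite -{1}['X^2]scale1r -exprS coef_exp_1DXn// dvdn_mulr// mulKn//.
by rewrite !expr1n mulr1 mul1r.
Qed.

(** With A = 1 + X the coefficient of X^k in A (1 + X^2)^k is nonzero for both
parities of k: 1 contributes when k is even and X when k is odd, which is how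
the floor of k/2 arises. *)
Lemma middle_binomial_alternating_sum (R : comNzRingType) (n : nat) :
  \sum_(0 <= k < n.+1)
     (-1) ^+ k * 'C(n, k)%:R * 'C(k, k./2)%:R * 2 ^+ (n - k)
  = 'C(2 * n, n)%:R - 'C(2 * n, n.+1)%:R :> R.
Proof.
have := @coef_trinomial R (1 + 'X) (-1) n.
rewrite (_ : 2%:R *: 'X + _ = - (1 + (-1) *: 'X^1) ^+ 2); last first.
  by rewrite !scale1r expr1 scaler_nat -mulr_natl !scaleN1r; ring.
have sgnP : (-1) ^+ n = ((-1) ^+ n)%:P :> {poly R}.
  by rewrite polyC_exp polyCN.
rewrite exprNn -exprM mulrCA sgnP coefCM mulrDl mul1r coefD coefXM.
rewrite !coef_exp_1DXn// !divn1 !dvd1n.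
case: n sgnP => [|n] _ /=.
  by move=> _; rewrite big_nat1 !expr0 bin0 [RHS]subr0 !mulr1.
have sgn2 : (-1) ^+ n * (-1) ^+ n = 1 :> R by rewrite -expr2 sqrr_sign.
have -> (a b : R) : (-1) ^+ n.+1 * ((-1) ^+ n.+1 * a + (-1) ^+ n * b) = a - b.
  transitivity ((-1) ^+ n * (-1) ^+ n * (a - b)); last by rewrite sgn2 mul1r.
  by rewrite exprS; ring.
have -> : 'C(2 * n.+1, n) = 'C(2 * n.+1, n.+2).
  by rewrite -[RHS]bin_sub; [congr binomial; lia|lia].
move=> ->; apply: eq_bigr => k _.
suff -> : ((1 + 'X) * (1 + 1 *: 'X^2) ^+ k : {poly R})`_k = 'C(k, k./2)%:R by ring.
rewrite mulrDl mul1r coefD coefXM !coef_exp_1DXn// !expr1n !mul1r.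
have [ok|ek] := boolP (odd k).
  rewrite ifN ?add0r; last lia.
  rewrite ifN ?ifT; [|lia|lia].
  by congr (_%:R); congr binomial; lia.
rewrite ifT; last lia.
rewrite divn2; case: k ek => [|k] ek /=; first by rewrite addr0.
by rewrite ifN ?addr0//; lia.
Qed.

(** * Catalan numbers and central binomial coefficients *)

Lemma pow4E (R : comNzRingType) (k : nat) : 4 ^+ k = 2 ^+ (2 * k) :> R.
Proof. by rewrite exprM expr2 -natrM. Qed.

Lemma middle_binomials_odd_row (k : nat) : 'C((2 * k).+1, k.+1) = 'C((2 * k).+1, k).
Proof. by rewrite -bin_sub; [congr binomial; lia|lia]. Qed.

Lemma central_binomialS (R : comNzRingType) (n : nat) :
  n.+1%:R * 'C(2 * n.+1, n.+1)%:R = (4 * n%:R + 2) * 'C(2 * n, n)%:R :> R.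
Proof.
have := mul_bin_diag (2 * n).+1 n; have := mul_bin_down (2 * n).+1 n.
rewrite (_ : (2 * n.+1)%N = (2 * n).+2); last by lia.
rewrite -!natrM -natrD => h1 h2.
rewrite -mul_bin_diag /= (_ : (2 * n).+1 - n = n.+1)%N in h1 *; last lia.
rewrite -!natrM; congr (_%:R); nia.
Qed.

Lemma catalanE (R : realType) (n : nat) :
  catalan R n = 'C(2 * n, n)%:R - 'C(2 * n, n.+1)%:R.
Proof.
have := mul_bin_left (2 * n) n; rewrite (_ : 2 * n - n = n)%N; last lia.
move/(congr1 (GRing.natmul (1 : R))); rewrite !natrM => h.
have n1 : n.+1%:R != 0 :> R by rewrite pnatr_eq0.
rewrite /catalan; apply: (mulfI n1).
by rewrite mulrBr h mulrA mulfV// -mulrBl -natr1; ring.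
Qed.

Lemma catalanSE (R : realType) (n : nat) :
  catalan R n.+1 = 'C(2 * n, n)%:R - 'C(2 * n, n.+2)%:R.
Proof.
rewrite catalanE (_ : (2 * n.+1)%N = (2 * n).+2); last by lia.
by rewrite [in X in X - _]binS -middle_binomials_odd_row !binS !natrD; ring.
Qed.

Lemma catalanS (R : realType) (n : nat) :
  n.+2%:R * catalan R n.+1 = (4 * n%:R + 2) * catalan R n.
Proof.
have h := central_binomialS R n; rewrite /catalan mulVKf ?pnatr_eq0//.
have n1 : n.+1%:R != 0 :> R by rewrite pnatr_eq0.
by apply: (mulfI n1); rewrite h [RHS]mulrCA mulVKf.
Qed.

(** Telescoping: 2 b_m / 4^m - 2 b_(m+1) / 4^(m+1) = C_m / 4^m. *)
Lemma catalan_series (R : realType) (m : nat) :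
  \sum_(0 <= j < m) catalan R j / 4 ^+ j = 2 - 2 * 'C(2 * m, m)%:R / 4 ^+ m.
Proof.
elim: m => [|m IHm]; first by rewrite big_geq// muln0 bin0 expr0; lra.
rewrite big_nat_recr//= IHm /catalan.
have n1 : m.+1%:R != 0 :> R by rewrite pnatr_eq0.
have -> : 'C(2 * m.+1, m.+1)%:R = m.+1%:R^-1 * (4 * m%:R + 2) * 'C(2 * m, m)%:R :> R.
  by rewrite -mulrA -central_binomialS mulrA mulVf// mul1r.
have p4 : 4 ^+ m != 0 :> R by rewrite expf_neq0// pnatr_eq0.
rewrite exprS -[m.+1%:R]natr1 in n1 *; field.
by rewrite p4 n1.
Qed.

(** For n = 2k - 1 and for n = 2k the left side has the same value
2 b_k / 4^k, and the right side the same number k of terms. *)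
Lemma middle_binomial_catalan_series (R : realType) (n : nat) :
  2 * 'C(n, n./2)%:R / 2 ^+ n
  = 2 - \sum_(0 <= j < n.+1./2) catalan R j / 4 ^+ j :> R.
Proof.
rewrite catalan_series opprB addrC subrK.
rewrite pow4E; have [on|en] := boolP (odd n).
- have [k ->] : exists k, n = (2 * k).+1 by exists n./2; lia.
  rewrite (_ : (2 * k).+1./2 = k)%N; last lia.
  rewrite (_ : (2 * k).+2./2 = k.+1)%N; last lia.
  rewrite (_ : 2 * k.+1 = (2 * k).+2)%N; last lia.
  rewrite binS middle_binomials_odd_row natrD [2 ^+ _.+2]exprS; field.
  by rewrite expf_neq0// pnatr_eq0.
- by rewrite (_ : 2 * n.+1./2 = n)%N; [congr (_ * 'C(_, _)%:R / _); lia|lia].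
Qed.

(** The factor 1 + (-1)^k selects the even k; the alternating half of the sum
vanishes because n > 0. *)
Lemma sum_even_binomials (R : realType) (n : nat) : (0 < n)%N ->
  \sum_(0 <= j < n./2.+1) 'C(n, 2 * j)%:R = 2 ^+ (n - 1) :> R.
Proof.
move=> n0; apply: (@mulfI _ 2); rewrite ?pnatr_eq0//.
rewrite -exprS subn1 prednK//.
have := @sum_even_terms R (fun k => (1 + (-1) ^+ k) * 'C(n, k)%:R) n.+1.
rewrite [uphalf _](_ : _ = n./2.+1); last lia.
move=> E; rewrite mulr_sumr; apply: etrans (esym (etrans _ (E _))).
- apply: eq_bigr => j _; rewrite exprM sqrrN expr1n expr1n; ring.
- under eq_bigr do rewrite mulrDl mul1r.
  rewrite big_split/= !big_mkord.
  have -> : \sum_(i < n.+1) (-1) ^+ i * 'C(n, i)%:R = (1 - 1) ^+ n :> R.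
    by rewrite exprDn; apply: eq_bigr => i _; rewrite expr1n mul1r mulr_natr.
  rewrite subrr expr0n -[n]prednK//= addr0.
  rewrite (exprDn (1 : R) 1); apply: eq_bigr => i _.
  by rewrite !expr1n mulr1.
- move=> i; by rewrite exprS exprM sqrrN !expr1n mulr1 subrr mul0r.
Qed.

Lemma central_binomial_catalan_sum (R : realType) (n : nat) : (0 < n)%N ->
  'C(2 * n, n)%:R
  = 2 * 4 ^+ (n - 1)
    - 2 ^+ (n - 1) *
      \sum_(1 <= j < n./2.+1)
         'C(n, 2 * j)%:R * \sum_(0 <= s < j) catalan R s / 4 ^+ s :> R.
Proof.
move=> n0; set S := \sum_(1 <= j < _) _.
have -> : S = 2 * 2 ^+ (n - 1) - 2 * 'C(2 * n, n)%:R / 2 ^+ n.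
  (* The term of index 0 vanishes, so the sum may start there. *)
  transitivity (\sum_(0 <= j < n./2.+1)
      'C(n, 2 * j)%:R * (2 - 2 * 'C(2 * j, j)%:R / 4 ^+ j) : R).
    rewrite [RHS]big_ltn// muln0 !bin0 expr0 divr1 !mulr1 subrr mulr0 add0r.
    by apply: eq_bigr => j _; rewrite catalan_series.
  rewrite -sum_even_binomials// -central_binomial_sum.
  rewrite !mulr_sumr mulr_suml -sumrB.
  apply: eq_big_nat => j /andP[_ jn]; rewrite pow4E.
  have -> : 2 ^+ n = 2 ^+ (n - 2 * j) * 2 ^+ (2 * j) :> R.
    by rewrite -exprD subnK//; lia.
  by field; rewrite !expf_neq0 ?pnatr_eq0.
have -> : 2 ^+ n = 2 * 2 ^+ (n - 1) :> R by rewrite -exprS subn1 prednK.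
have -> : 4 ^+ (n - 1) = 2 ^+ (n - 1) * 2 ^+ (n - 1) :> R.
  by rewrite -exprMn -natrM.
by field; rewrite expf_neq0 ?pnatr_eq0.
Qed.

(** Since C(2j+2, j+1) = 2 C(2j+1, j), the sum is twice that of
[next_central_binomial_sum]. *)
Lemma catalanS_central_binomial_sum (R : realType) (n : nat) :
  catalan R n.+1
  = 2 * 'C(2 * n, n)%:R
    - 1 / 2 *
      \sum_(0 <= j < n./2.+1)
         'C(n, 2 * j)%:R * 2 ^+ (n - 2 * j) * 'C(2 * j + 2, j + 1)%:R.
Proof.
have h := next_central_binomial_sum R n; rewrite catalanSE.
rewrite (_ : \sum_(0 <= j < _) _ = 2 * ('C(2 * n, n)%:R + 'C(2 * n, n.+2)%:R)).
  by field.
rewrite -h mulr_sumr; apply: eq_bigr => j _.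
by rewrite addn1 addn2 binS middle_binomials_odd_row natrD; ring.
Qed.

(** * The coefficients d_n *)

(** The coefficient of x^n in 1 / sqrt((1 + 4x)(1 - 4x)), the product of the
generating series of (-1)^k b_k and of b_k. *)
Definition alt_conv (R : comNzRingType) (n : nat) : R :=
  \sum_(k < n.+1) (-1) ^+ k * 'C(2 * k, k)%:R * 'C(2 * (n - k), n - k)%:R.

(** Multiplying a coefficient by its index is differentiation.  For
A = 1 / sqrt(1 + 4z) and E = 1 / sqrt(1 - 4z) this is the pair of rules
(1 + 4z) A' = -2A and (1 - 4z) E' = 2E, applied inside x A' E + y A E' with
constant weights x and y. *)
Lemma alt_conv_weight (R : comNzRingType) (x y : R) (n : nat) :
  \sum_(k < n.+2) (x * k%:R + y * (n.+1 - k)%:R) *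
     ((-1) ^+ k * 'C(2 * k, k)%:R * 'C(2 * (n.+1 - k), n.+1 - k)%:R)
  = \sum_(k < n.+1) (y * (4 * (n - k)%:R + 2) - x * (4 * k%:R + 2)) *
     ((-1) ^+ k * 'C(2 * k, k)%:R * 'C(2 * (n - k), n - k)%:R).
Proof.
under eq_bigr do rewrite mulrDl.
rewrite big_split/= big_ord_recl [X in _ + X]big_ord_recr/=.
rewrite subnn !mulr0 !mul0r add0r addr0 -big_split/=.
apply: eq_bigr => k _; rewrite /bump/= add1n subSS.
rewrite (_ : n.+1 - k = (n - k).+1)%N; last by have := ltn_ord k; lia.
have h1 := central_binomialS R k; have h2 := central_binomialS R (n - k).
rewrite (_ : x * _ * _ = - (x * (-1) ^+ k * 'C(2 * (n - k), n - k)%:R) *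
    (k.+1%:R * 'C(2 * k.+1, k.+1)%:R)); last by rewrite exprS; ring.
rewrite (_ : y * _ * _ = (y * (-1) ^+ k * 'C(2 * k, k)%:R) *
    ((n - k).+1%:R * 'C(2 * (n - k).+1, (n - k).+1)%:R)); last by ring.
by rewrite h1 h2; ring.
Qed.

(** The differential equation (1 - 16 z^2) P' = 16 z P of P = A E, read on
coefficients: two successive uses of [alt_conv_weight], with weights (1, 1) and
then (-4, 4), after which the weight of every term is 16 (n + 1). *)
Lemma alt_convSS (R : comNzRingType) (n : nat) :
  n.+2%:R * alt_conv R n.+2 = 16 * (n.+1%:R * alt_conv R n).
Proof.
pose t m k : R := (-1) ^+ k * 'C(2 * k, k)%:R * 'C(2 * (m - k), m - k)%:R.
transitivity (\sum_(k < n.+3) (1 * k%:R + 1 * (n.+2 - k)%:R) * t n.+2 k).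
  rewrite /alt_conv mulr_sumr; apply: eq_bigr => k _.
  by rewrite !mul1r -natrD subnKC// -ltnS.
rewrite alt_conv_weight.
transitivity (\sum_(k < n.+2) (- 4 * k%:R + 4 * (n.+1 - k)%:R) * t n.+1 k).
  by apply: eq_bigr => k _; rewrite /t; ring.
rewrite alt_conv_weight /alt_conv !mulr_sumr; apply: eq_bigr => k _.
have -> : n.+1%:R = k%:R + (n - k)%:R + 1 :> R.
  by rewrite -natrD subnKC ?natr1// -ltnS.
by ring.
Qed.

Lemma alt_conv_odd (R : realType) (k : nat) : alt_conv R (2 * k).+1 = 0.
Proof.
elim: k => [|k IHk].
  by rewrite /alt_conv !big_ord_recr big_ord0 /= muln0 muln1 bin0 bin1; ring.
have := alt_convSS R (2 * k).+1; rewrite IHk !mulr0.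
rewrite (_ : (2 * k).+3 = (2 * k.+1).+1)%N; last lia.
by move=> /eqP; rewrite mulf_eq0 pnatr_eq0/= => /eqP.
Qed.

Lemma alt_conv_even (R : realType) (k : nat) :
  alt_conv R (2 * k) = 4 ^+ k * 'C(2 * k, k)%:R.
Proof.
elim: k => [|k IHk].
  by rewrite /alt_conv big_ord_recr big_ord0 /= muln0 bin0; ring.
have := alt_convSS R (2 * k).
rewrite (_ : (2 * k).+2 = 2 * k.+1)%N; last lia.
have n1 : (2 * k.+1)%:R != 0 :> R by rewrite pnatr_eq0.
move=> h; apply: (mulfI n1); rewrite h IHk natrM exprS.
have := central_binomialS R k => hb.
rewrite (_ : 2 * k.+1%:R * (4 * 4 ^+ k * 'C(2 * k.+1, k.+1)%:R) =
  2 * 4 * 4 ^+ k * (k.+1%:R * 'C(2 * k.+1, k.+1)%:R)); last by ring.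
by rewrite hb -[(2 * k).+1%:R]natr1 natrM; ring.
Qed.

(** The identity sqrt(1 - 4x) = (1 - 4x) / sqrt(1 - 4x) on coefficients:
-2 C_(m-1) is the m-th coefficient of sqrt(1 - 4x), the value C_(-1) = -1/2
being the one that makes this true for m = 0. *)
Lemma catalanz_pred (R : realType) (m : nat) :
  catalanz R (m%:Z - 1) =
  - (1 / 2) * ('C(2 * m, m)%:R - (0 < m)%:R * 4 * 'C(2 * m.-1, m.-1)%:R).
Proof.
case: m => [|m]; first by rewrite add0r /= muln0 bin0 !mul0r subr0 mulr1.
rewrite (_ : m.+1%:Z - 1 = m%:Z); last by lia.
have n1 : m.+1%:R != 0 :> R by rewrite pnatr_eq0.
rewrite /= /catalan; apply: (mulfI n1); rewrite mulVKf// mulrCA mulrBr central_binomialS.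
by rewrite -natr1; field.
Qed.

(** The sum defining d_n is the convolution of (-1)^k b_k with C_(m-1), hence
by [catalanz_pred], up to normalisation, a coefficient of (1 - 4x) / sqrt(1 - 16 x^2). *)
Lemma dcoefE (R : realType) (n : nat) :
  dcoef R n = n`!%:R / 4 ^+ n * (alt_conv R n - (0 < n)%:R * 4 * alt_conv R n.-1).
Proof.
have m1 (k : nat) : (-1 : R) ^ (k%:Z - 1) = - (-1) ^+ k.
  by rewrite expfzDr ?oppr_eq0 ?oner_eq0// exprN1 invrN1 mulrN1.
have p4 : (4 : R) ^ (n%:Z - 1) = 4 ^+ n / 4.
  by rewrite expfzDr ?pnatr_eq0.
rewrite /dcoef p4 (_ : \sum_(0 <= k < n.+1) _ =
    (1 / 2) * (alt_conv R n - (0 < n)%:R * 4 * alt_conv R n.-1)).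
  by field; rewrite expf_neq0 ?pnatr_eq0.
rewrite big_mkord.
transitivity (\sum_(k < n.+1) (1 / 2) *
   ((-1) ^+ k * 'C(2 * k, k)%:R * 'C(2 * (n - k), n - k)%:R
    - (0 < n - k)%:R * 4 *
      ((-1) ^+ k * 'C(2 * k, k)%:R * 'C(2 * (n - k).-1, (n - k).-1)%:R)) : R).
  apply: eq_bigr => k _; rewrite m1.
  rewrite (_ : n%:Z - k%:Z = (n - k)%:Z); last by have := ltn_ord k; lia.
  by rewrite catalanz_pred; ring.
rewrite -mulr_sumr; congr (_ * _); rewrite sumrB; congr (_ - _).
rewrite big_ord_recr/= subnn !mul0r addr0.
case: n {p4} => [|n]; first by rewrite big_ord0 !mul0r.
rewrite mul1r /alt_conv mulr_sumr; apply: eq_bigr => k _.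
rewrite (_ : n.+1 - k = (n - k).+1)%N; last by have := ltn_ord k; lia.
by rewrite mul1r.
Qed.

Lemma dcoef_even (R : realType) (k : nat) :
  dcoef R (2 * k) = (2 * k)`!%:R * ('C(2 * k, k)%:R / 4 ^+ k).
Proof.
rewrite dcoefE alt_conv_even.
have -> : (0 < 2 * k)%:R * 4 * alt_conv R (2 * k).-1 = 0.
  case: k => [|k]; first by rewrite muln0 !mul0r.
  by rewrite (_ : (2 * k.+1).-1 = (2 * k).+1)%N ?alt_conv_odd ?mulr0//; lia.
rewrite subr0 mul2n -addnn exprD; field.
by rewrite expf_neq0 ?pnatr_eq0.
Qed.

Lemma dcoef_odd (R : realType) (k : nat) :
  dcoef R (2 * k).+1 = - ((2 * k).+1`!%:R * ('C(2 * k, k)%:R / 4 ^+ k)).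
Proof.
rewrite dcoefE alt_conv_odd /= alt_conv_even exprS mul2n -addnn exprD; field.
by rewrite expf_neq0 ?pnatr_eq0.
Qed.

(** * Moments of the semicircle *)

Lemma Rintegral_FTC (R : realType) (f F : R -> R) (a b : R) : a < b ->
  continuous f -> {within `[a, b], continuous F} ->
  (forall x, a < x < b -> is_derive x 1 F (f x)) ->
  \int[lebesgue_measure]_(x in `[a, b]) f x = F b - F a.
Proof.
move=> ab cf cF dF; rewrite /Rintegral (@continuous_FTC2 _ f F)//.
- exact: continuous_subspaceT.
- have /(continuous_within_itvP _ ab)[_ cFa cFb] := cF; split => // x.
  by rewrite in_itv/= => /dF[].
- by move=> x; rewrite in_itv/= derive1E => /dF[].
Qed.

Lemma continuous_integrable (R : realType) (f : R -> R) (a b : R) :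
  continuous f ->
  (@lebesgue_measure R).-integrable `[a, b] (EFin \o f).
Proof.
move=> cf; apply: continuous_compact_integrable.
  exact: segment_compact.
exact: continuous_subspaceT.
Qed.

Lemma Rintegral_affine (R : realType) (f : R -> R) (p q a b : R) :
  0 < p -> a < b -> continuous f ->
  \int[lebesgue_measure]_(x in `[p * a + q, p * b + q]) f x
  = p * \int[lebesgue_measure]_(x in `[a, b]) f (p * x + q).
Proof.
move=> p0 ab cf; pose L x := p * x + q.
have dL (x : R) : is_derive x 1 L p.
  have -> : p = p *: 1 + 0 by rewrite addr0 /GRing.scale/= mulr1.
  exact: (is_deriveD (is_deriveZ _ (is_derive_id _ _)) (is_derive_cst _ _ _)).
have L' : derive1 L = cst p by apply/funext => x; rewrite derive1E; case: (dL x).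
have cL : continuous L.
  by move=> x; apply: differentiable_continuous; apply/derivable1_diffP; case: (dL x).
have cfL : continuous (f \o L).
  by move=> x; apply: continuous_comp; [exact: cL|exact: cf].
rewrite -RintegralZl//; last exact: continuous_integrable.
rewrite /Rintegral -/(L a) -/(L b) integration_by_substitution_increasing//.
- by congr fine; apply: eq_integral => x _; rewrite /= L' mulrC.
- exact: ltW.
- by move=> x y _ _ xy; rewrite /L ltrD2r ltr_pM2l.
- by rewrite L' => x _; exact: cst_continuous.
- by rewrite L'; exact: is_cvg_cst.
- by rewrite L'; exact: is_cvg_cst.
- split; first by move=> x _; case: (dL x).
  + exact/cvg_at_right_filter/cL.
  + exact/cvg_at_left_filter/cL.
- exact: continuous_subspaceT.
Qed.

(** At the endpoints the arcsine has no derivative; its continuity there comes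
from its being the inverse of a continuous function on a segment. *)
Lemma asin_within_continuous (R : realType) :
  {within `[-1, 1], continuous (@asin R)}.
Proof.
have := @segment_can_le_continuous R (- (pi / 2)) (pi / 2) sin asin.
rewrite sinN sin_pihalf; apply.
- by rewrite lerNl -subr_ge0; have := pi_ge0 R; lra.
- by apply: continuous_subspaceT => x; exact: continuous_sin.
- exact: sinK.
Qed.

Section semicircle.
Context (R : realType).
Implicit Types (a x : R) (P : {poly R}).

Let s x : R := Num.sqrt (1 - x ^+ 2).

Let sE : s = Num.sqrt \o horner (1 - 'X^2).
Proof. by apply/funext => x; rewrite /= !hornerE. Qed.

Let s_gt0 x : -1 < x < 1 -> 0 < s x.
Proof. by move=> x1; rewrite sqrtr_gt0; nra. Qed.

Let sqr_s x : -1 < x < 1 -> s x ^+ 2 = 1 - x ^+ 2.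
Proof. by move=> x1; rewrite sqr_sqrtr//; nra. Qed.

Let continuous_s : continuous s.
Proof.
rewrite sE => x; apply: continuous_comp; first exact: continuous_horner.
exact: sqrt_continuous.
Qed.

Let is_derive_s x : -1 < x < 1 -> is_derive x 1 s (- x / s x).
Proof.
move=> x1; have s0 := s_gt0 _ x1.
have p0 : 0 < (1 - 'X^2).[x] :> R by rewrite !hornerE; nra.
have := is_derive1_comp (is_derive1_sqrt p0) (is_derive_poly (1 - 'X^2) x).
rewrite -sE (_ : Num.sqrt _ = s x); last by rewrite sE.
move/is_derive_eq; apply; rewrite derivB derivXn derivC !hornerE.
by field; rewrite gt_eqF.
Qed.

Lemma continuous_semicircle P : continuous (fun x => P.[x] * s x).
Proof.
by move=> x; apply: continuousM; [exact: continuous_horner|exact: continuous_s].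
Qed.

(** The integrand is the derivative of P(x) (1 - x^2)^(3/2), which vanishes at 1.
Writing the antiderivative as ((1 - x^2) P(x)) sqrt(1 - x^2) keeps it
polynomial apart from the square root. *)
Lemma Rintegral_semicircle_deriv a P : a < 1 -> -1 <= a ->
  \int[lebesgue_measure]_(x in `[a, 1]) (((1 - 'X^2) * P^`() - 3 *: 'X * P).[x] * s x)
  = - ((1 - a ^+ 2) * P.[a] * s a).
Proof.
move=> a1 a_geN1; pose F x : R := ((1 - 'X^2) * P).[x] * s x.
apply: (etrans (@Rintegral_FTC _ _ F _ _ a1 _ _ _)).
- exact: continuous_semicircle.
- apply: continuous_subspaceT; exact: continuous_semicircle.
- move=> x /andP[ax x1]; have x1' : -1 < x < 1 by lra.
  have s0 := s_gt0 _ x1'; have := is_derive_s _ x1'.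
  have : (1 - x ^+ 2) * (- x / s x) = - x * s x.
    by rewrite -(sqr_s _ x1'); field; rewrite gt_eqF.
  move: (- x / s x) => d Ed ds.
  have := is_deriveM (is_derive_poly ((1 - 'X^2) * P) x) ds.
  move/is_derive_eq; apply; rewrite /GRing.scale/= derivM derivB derivXn derivC.
  by rewrite !hornerE mulrAC Ed; ring.
- by rewrite /F !hornerE; ring.
Qed.

(** The lower end is left free: -1 gives the moments of the semicircle law, and
0 those of its right half, which are positive for every order. *)
Definition semicircle_moment a n : R :=
  \int[lebesgue_measure]_(x in `[a, 1]) (x ^+ n * Num.sqrt (1 - x ^+ 2)).

Let continuous_xs n : continuous (fun x => x ^+ n * s x).
Proof.
by move=> x; apply: cvgM; [exact: exprn_continuous|exact: continuous_s].
Qed.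

Let continuous_cxs c n : continuous (fun x => c * (x ^+ n * s x)).
Proof.
by move=> x; apply: cvgM; [exact: cst_continuous|exact: continuous_xs].
Qed.

(** The condition on a removes the boundary term at a; it holds for a = -1 and
for a = 0. *)
Lemma semicircle_momentSS a n : -1 <= a < 1 -> a ^+ n.+1 * (1 - a ^+ 2) = 0 ->
  n.+4%:R * semicircle_moment a n.+2 = n.+1%:R * semicircle_moment a n.
Proof.
move=> /andP[a1 a1'] a0; have := @Rintegral_semicircle_deriv a 'X^(n.+1) a1' a1.
rewrite hornerXn (_ : (1 - _) * _ * _ = (a ^+ n.+1 * (1 - a ^+ 2)) * s a); last ring.
rewrite a0 mul0r oppr0 derivXn /= => h.
apply/eqP; rewrite eq_sym -subr_eq0 -{}h /semicircle_moment; apply/eqP.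
rewrite -!RintegralZl//; try exact/continuous_integrable/continuous_xs.
rewrite -RintegralB//; try exact/continuous_integrable/continuous_cxs.
apply: eq_Rintegral => x _; rewrite -/(s x).
have one_x : (1 : {poly R}).[x] = 1 by rewrite hornerC.
rewrite !(one_x, hornerD, hornerN, hornerM, hornerZ, hornerMn, hornerX).
rewrite !(hornerXn, hornerC).
have -> : n.+4%:R = n.+1%:R + 3 :> R by rewrite -natrD addn3.
by rewrite -mulr_natl [x ^+ n.+2]exprS [x ^+ n.+1]exprS; ring.
Qed.

Lemma semicircle_moment1 a : -1 <= a < 1 ->
  3 * semicircle_moment a 1 = (1 - a ^+ 2) * s a.
Proof.
move=> /andP[a1 a1'].
have one_x x : (1 : {poly R}).[x] = 1 by rewrite hornerC.
have -> : (1 - a ^+ 2) * s a = - - ((1 - a ^+ 2) * (1 : {poly R}).[a] * s a).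
  by rewrite opprK one_x mulr1.
rewrite -Rintegral_semicircle_deriv// /semicircle_moment -mulN1r -!RintegralZl//.
- apply: eq_Rintegral => x _; rewrite derivC -/(s x).
  by rewrite !(one_x, hornerD, hornerN, hornerM, hornerZ, hornerX, hornerC); ring.
- exact/continuous_integrable/continuous_semicircle.
- exact/continuous_integrable/continuous_xs.
Qed.

(** An antiderivative of sqrt(1 - x^2) is (x sqrt(1 - x^2) + arcsin x) / 2. *)
Lemma semicircle_moment0 a : -1 <= a < 1 ->
  2 * semicircle_moment a 0 = pi / 2 - a * s a - asin a.
Proof.
move=> /andP[a1 a1']; pose F x : R := 2^-1 * (x * s x + asin x).
have s1 : s 1 = 0 by rewrite /s expr1n subrr sqrtr0.
have asin1 : asin 1 = pi / 2 :> R.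
  rewrite -[X in asin X]sin_pihalf sinK ?in_itv/= ?lexx ?andbT//.
  by have := pi_ge0 R; lra.
suff -> : semicircle_moment a 0 = F 1 - F a by rewrite /F s1 asin1; field.
transitivity (\int[lebesgue_measure]_(x in `[a, 1]) (x ^+ 0 * s x)) => //.
apply: Rintegral_FTC => //.
- have /subspace_continuousP cA : {within `[a, 1], continuous (@asin R)}.
    apply: continuous_subspaceW (@asin_within_continuous R) => x /=.
    by rewrite !in_itv/= => /andP[ax ->]; rewrite (le_trans a1 ax).
  apply/subspace_continuousP => x ax; apply: cvgM; first exact: cvg_cst.
  apply: cvgD; last exact: cA.
  by apply: cvg_within_filter; exact: (continuous_xs 1 x).
- move=> x /andP[ax x1]; have x1' : -1 < x < 1 by lra.
  have s0 := s_gt0 _ x1'; have := is_derive_s _ x1'.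
  have : x * (- x / s x) + (s x)^-1 = s x.
    have sn0 : s x != 0 by rewrite gt_eqF.
    by apply: (mulIf sn0); rewrite -expr2 (sqr_s _ x1'); field.
  move: (- x / s x) => d Ed ds.
  have := is_deriveZ 2^-1 (is_deriveD (is_deriveM (is_derive_id x (1 : R)) ds)
     (is_derive1_asin x1')).
  move/is_derive_eq; apply; rewrite /GRing.scale/= -/(s x) addrAC Ed expr0.
  by field.
Qed.

End semicircle.

(** * The beta laws with parameters (3/2, 3/2) and (1, 2) *)

Lemma catalan0 (R : realType) : catalan R 0 = 1.
Proof. by rewrite /catalan muln0 bin0 mulr1 invr1. Qed.

(** The ratio of consecutive even moments, (2k+1) / (2k+4), is a quarter of the
ratio of consecutive Catalan numbers. *)
Lemma semicircle_moment_even (R : realType) (a : R) (k : nat) :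
  -1 <= a < 1 -> (forall n, a ^+ n.+1 * (1 - a ^+ 2) = 0) ->
  semicircle_moment R a (2 * k) = semicircle_moment R a 0 * (catalan R k / 4 ^+ k).
Proof.
move=> a1 a0; elim: k => [|k IHk].
  by rewrite muln0 catalan0 divr1 mulr1.
rewrite (_ : 2 * k.+1 = (2 * k).+2)%N; last lia.
have n4 : (2 * k).+4%:R != 0 :> R by rewrite pnatr_eq0.
apply: (mulfI n4); rewrite semicircle_momentSS// IHk.
have -> : (2 * k).+4%:R = 2 * k.+2%:R :> R by rewrite -natrM; congr (_%:R); lia.
rewrite exprS (_ : 2 * _ * (_ * _) =
  2 * semicircle_moment R a 0 / (4 * 4 ^+ k) * (k.+2%:R * catalan R k.+1)); last first.
  by field; rewrite expf_neq0 ?pnatr_eq0.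
rewrite catalanS -natr1 natrM; field.
by rewrite expf_neq0 ?pnatr_eq0.
Qed.

Lemma semicircle_moment_full_odd (R : realType) (k : nat) :
  semicircle_moment R (-1) (2 * k).+1 = 0.
Proof.
have a1 : -1 <= (-1 : R) < 1 by lra.
elim: k => [|k IHk].
  have := semicircle_moment1 _ _ a1; rewrite sqrrN expr1n subrr mul0r muln0.
  by move/eqP; rewrite mulf_eq0 pnatr_eq0/= => /eqP.
have := @semicircle_momentSS R (-1) (2 * k).+1 a1.
rewrite sqrrN expr1n subrr mulr0 IHk mulr0 => /(_ erefl)/eqP.
rewrite mulf_eq0 pnatr_eq0/= => /eqP.
by rewrite (_ : (2 * k.+1).+1 = (2 * k).+3)%N//; lia.
Qed.

Lemma semicircle_moment_full_even (R : realType) (k : nat) :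
  semicircle_moment R (-1) (2 * k) = pi / 2 * (catalan R k / 4 ^+ k).
Proof.
have a1 : -1 <= (-1 : R) < 1 by lra.
rewrite semicircle_moment_even//; last first.
  by move=> n; rewrite sqrrN expr1n subrr mulr0.
congr (_ * _); have := semicircle_moment0 _ _ a1.
have -> : asin (-1) = - (pi / 2) :> R.
  rewrite -[X in asin (- X)]sin_pihalf -sinN sinK ?in_itv/= ?lexx//.
  by have := pi_ge0 R; lra.
rewrite sqrrN expr1n subrr sqrtr0; lra.
Qed.

Lemma semicircle_moment_half_even (R : realType) (k : nat) :
  semicircle_moment R 0 (2 * k) = pi / 4 * (catalan R k / 4 ^+ k).
Proof.
have a1 : -1 <= (0 : R) < 1 by lra.
rewrite semicircle_moment_even//; last by move=> n; rewrite expr0n/= mul0r.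
congr (_ * _); have := semicircle_moment0 _ _ a1.
have -> : asin 0 = 0 :> R.
  rewrite -[X in asin X]sin0 sinK ?in_itv//=.
  by have := pi_ge0 R; lra.
rewrite mul0r; lra.
Qed.

Lemma powR_half (R : realType) (x : R) : 0 <= x -> x `^ (3 / 2 - 1) = Num.sqrt x.
Proof. by move=> x0; rewrite (_ : 3 / 2 - 1 = 2^-1) ?powR12_sqrt//; lra. Qed.

Lemma continuous_sqrt_horner (R : realType) (P Q : {poly R}) :
  continuous (fun x => P.[x] * Num.sqrt Q.[x]).
Proof.
move=> x; apply: cvgM; first exact: continuous_horner.
apply: (@continuous_comp _ _ _ (horner Q) Num.sqrt); first exact: continuous_horner.
exact: sqrt_continuous.
Qed.

(** The substitution x = 2t - 1 maps the integral to the total mass of the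
semicircle. *)
Lemma euler_beta_3halves (R : realType) : euler_beta (3 / 2 : R) (3 / 2) = pi / 8.
Proof.
have cf : continuous (fun x : R => Num.sqrt (1 - x ^+ 2)).
  rewrite (_ : (fun _ => _) = fun x => 1.[x] * Num.sqrt (1 - 'X^2).[x]).
    exact: continuous_sqrt_horner.
  by apply/funext => x; rewrite !hornerE.
have := @Rintegral_affine R _ 2 (-1) 0 1 (ltr0n _ 2) ltr01 cf.
rewrite (_ : 2 * 0 + -1 = -1); last by lra.
rewrite (_ : 2 * 1 + -1 = 1); last by lra.
have := semicircle_moment_full_even R 0; rewrite /semicircle_moment muln0.
under eq_Rintegral do rewrite expr0 mul1r.
rewrite catalan0 divr1 mulr1 => -> h.
rewrite (_ : euler_beta _ _ = \int[lebesgue_measure]_(x in `[0, 1])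
    (2^-1 * Num.sqrt (1 - (2 * x + -1) ^+ 2))).
  rewrite RintegralZl//; first by lra.
  have := @continuous_sqrt_horner R 1 (1 - (2 *: 'X - 1) ^+ 2) => c.
  have := @continuous_integrable R _ 0 1 c; congr (_.-integrable _ _).
  by apply/funext => x; rewrite /= !hornerE.
apply: eq_Rintegral => x; rewrite inE/= in_itv/= => /andP[x0 x1].
rewrite !powR_half ?subr_ge0// -sqrtrM//.
rewrite [X in _ * Num.sqrt X](_ : _ = 2 ^+ 2 * (x * (1 - x))); last by ring.
by rewrite [in RHS]sqrtrM ?sqr_ge0// sqrtr_sqr ger0_norm// mulKf ?pnatr_eq0.
Qed.

Lemma moment_semicircle (R : realType) (n : nat) :
  moment (3 / 2 : R) (3 / 2) n = 2 ^+ n.+1 / pi * semicircle_moment R (-1) n.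
Proof.
have pi0 : (pi : R) != 0 by rewrite gt_eqF// pi_gt0.
pose g (x : R) := x ^+ n / (2 * pi) * Num.sqrt (4 - x ^+ 2).
have cg : continuous g.
  rewrite (_ : g = fun x => ((2 * pi)^-1 *: 'X^n).[x] * Num.sqrt (4%:P - 'X^2).[x]).
    exact: continuous_sqrt_horner.
  by apply/funext => x; rewrite !hornerE /g [_^-1 * _]mulrC.
rewrite (_ : moment _ _ _ = \int[lebesgue_measure]_(x in `[-2, 2]) g x); last first.
  apply: eq_Rintegral => x; rewrite inE/= in_itv/= => /andP[x0 x1].
  rewrite !powR_half ?subr_ge0//; last lra.
  rewrite -sqrtrM; last lra.
  rewrite euler_beta_3halves (_ : 3 / 2 + 3 / 2 - 1 = 2%:R); last lra.
  rewrite powR_mulrn// (_ : (x + 2) * (2 - x) = 4 - x ^+ 2); last by ring.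
  have scal (p u v : R) : p != 0 -> u * (v / (4 ^+ 2 * (p / 8))) = u / (2 * p) * v.
    by move=> p0; field.
  exact: (scal _ _ _ pi0).
have := @Rintegral_affine R g 2 0 (-1) 1 (ltr0n _ 2) _ cg.
rewrite (_ : 2 * -1 + 0 = -2); last by lra.
rewrite (_ : 2 * 1 + 0 = 2); last by lra.
move=> ->; last by lra.
rewrite (_ : \int[_]_(x in _) g _ = \int[lebesgue_measure]_(x in `[-1, 1])
   (2 ^+ n / pi * (x ^+ n * Num.sqrt (1 - x ^+ 2)))).
  rewrite RintegralZl//; first by rewrite exprS !mulrA.
  have := @continuous_sqrt_horner R 'X^n (1 - 'X^2) => c.
  have := @continuous_integrable R _ (-1) 1 c; congr (_.-integrable _ _).
  by apply/funext => x; rewrite /= !hornerE.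
apply: eq_Rintegral => x _; rewrite /g addr0.
rewrite (_ : 4 - _ = 2 ^+ 2 * (1 - x ^+ 2)); last by ring.
rewrite sqrtrM ?sqr_ge0// sqrtr_sqr ger0_norm// exprMn.
by move: (pi : R) pi0 => p p0; field.
Qed.

Lemma moment_semicircle_even (R : realType) (k : nat) :
  moment (3 / 2 : R) (3 / 2) (2 * k) = catalan R k.
Proof.
rewrite moment_semicircle semicircle_moment_full_even exprS -pow4E.
have : (pi : R) != 0 by rewrite gt_eqF// pi_gt0.
move: (pi : R) => p p0; field.
by rewrite expf_neq0 ?pnatr_eq0.
Qed.

Lemma moment_semicircle_odd (R : realType) (k : nat) :
  moment (3 / 2 : R) (3 / 2) (2 * k).+1 = 0.
Proof. by rewrite moment_semicircle semicircle_moment_full_odd mulr0. Qed.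

Lemma moment_semicircle_middle_binomials (R : realType) (n : nat) :
  moment (3 / 2 : R) (3 / 2) n
  = 2 * 'C(n, n./2)%:R - 'C(n.+1, n.+1./2)%:R.
Proof.
have [on|en] := boolP (odd n).
- have -> : n = (2 * n./2).+1 by lia.
  move: n./2 => k; rewrite moment_semicircle_odd.
  rewrite (_ : (2 * k).+1./2 = k)%N; last lia.
  rewrite (_ : (2 * k).+2./2 = k.+1)%N; last lia.
  by rewrite binS middle_binomials_odd_row natrD; ring.
- have -> : n = (2 * n./2)%N by lia.
  move: n./2 => k; rewrite moment_semicircle_even.
  rewrite (_ : (2 * k)./2 = k)%N; last lia.
  rewrite (_ : (2 * k).+1./2 = k)%N; last lia.
  by rewrite -middle_binomials_odd_row binS catalanE natrD; ring.
Qed.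

Lemma Rintegral_deriv_poly (R : realType) (p : {poly R}) (a b : R) : a < b ->
  \int[lebesgue_measure]_(x in `[a, b]) p^`().[x] = p.[b] - p.[a].
Proof.
move=> ab; apply: Rintegral_FTC => //; first exact: continuous_horner.
by apply: continuous_subspaceT; exact: continuous_horner.
Qed.

Lemma euler_beta12 (R : realType) : euler_beta (1 : R) 2 = 1 / 2.
Proof.
transitivity (\int[lebesgue_measure]_(x in `[0 : R, 1]) ('X - 2^-1 *: 'X^2)^`().[x]).
  apply: eq_Rintegral => x; rewrite inE/= in_itv/= => /andP[x0 x1].
  rewrite subrr powRr0 mul1r (_ : 2 - 1 = 1); last by lra.
  rewrite powRr1 ?subr_ge0// derivB derivX derivZ derivXn !hornerE.
  by field.
rewrite Rintegral_deriv_poly ?ltr01//.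
by rewrite !(hornerD, hornerN, hornerZ, hornerXn, hornerX) expr1n expr0n /=; field.
Qed.

(** B(1, 2) = 1/2, so the density is (2 - x) / 8 on [-2, 2]. *)
Lemma moment_linear (R : realType) (n : nat) :
  moment (1 : R) 2 n =
  2 ^+ n.+1 / 4 * ((1 + (-1) ^+ n) / n.+1%:R - (1 - (-1) ^+ n) / n.+2%:R).
Proof.
have n1 : n.+1%:R != 0 :> R by rewrite pnatr_eq0.
have n2 : n.+2%:R != 0 :> R by rewrite pnatr_eq0.
pose p : {poly R} := (4 * n.+1%:R)^-1 *: 'X^(n.+1) - (8 * n.+2%:R)^-1 *: 'X^(n.+2).
transitivity (\int[lebesgue_measure]_(x in `[-2 : R, 2]) p^`().[x]).
  apply: eq_Rintegral => x; rewrite inE/= in_itv/= => /andP[x0 x1].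
  rewrite subrr powRr0 mul1r euler_beta12 (_ : 2 - 1 = 1 :> R); last by lra.
  rewrite powRr1 ?subr_ge0// (_ : 1 + 2 - 1 = 2%:R :> R); last by lra.
  rewrite powR_mulrn// /p derivB !derivZ !derivXn.
  rewrite !(hornerMn, hornerD, hornerN, hornerZ, hornerXn).
  rewrite /= -[x ^+ n *+ _]mulr_natr -[x ^+ n.+1 *+ _]mulr_natr [x ^+ n.+1]exprS.
  have scal (u v y k l : R) : k != 0 -> l != 0 ->
      u * ((2 - y) / (4 ^+ 2 * (1 / 2))) =
      (4 * k)^-1 * (u * k) - (8 * l)^-1 * (y * u * l).
    by move=> k0 l0; field; rewrite k0 l0.
  exact: scal.
rewrite Rintegral_deriv_poly; last by lra.
rewrite /p !(hornerD, hornerN, hornerZ, hornerXn) ![(-2) ^+ _]exprNn !exprS.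
by field; rewrite -natrD nat1r !pnatr_eq0.
Qed.

Lemma moment_linear_even (R : realType) (j : nat) :
  moment (1 : R) 2 (2 * j) = 4 ^+ j / (2 * j + 1)%:R.
Proof.
rewrite moment_linear exprS [(-1) ^+ _]exprM sqrrN !expr1n subrr mul0r subr0 -pow4E addn1.
have : (2 * j).+1%:R != 0 :> R by rewrite pnatr_eq0.
by move: ((2 * j).+1%:R : R) => d d0; field.
Qed.

Lemma moment_linear_odd (R : realType) (j : nat) :
  moment (1 : R) 2 (2 * j).+1 = - 2 * 2 ^+ (2 * j) / (2 * j + 3)%:R.
Proof.
rewrite moment_linear !exprS [(-1) ^+ (2 * j)]exprM sqrrN !expr1n addn3.
rewrite mulr1 subrr mul0r sub0r opprK.
have : (2 * j).+3%:R != 0 :> R by rewrite pnatr_eq0.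
by move: ((2 * j).+3%:R : R) => d d0; field.
Qed.

(** * Wallis' limit *)

Lemma semicircle_moment_le (R : realType) (n : nat) :
  semicircle_moment R 0 n.+1 <= semicircle_moment R 0 n.
Proof.
have int k : (@lebesgue_measure R).-integrable `[0, 1]
    (EFin \o (fun x => x ^+ k * Num.sqrt (1 - x ^+ 2))).
  have := @continuous_integrable R _ 0 1 (@continuous_sqrt_horner R 'X^k (1 - 'X^2)).
  by congr (_.-integrable _ _); apply/funext => x; rewrite /= !hornerE.
apply: le_Rintegral => //; rewrite /= => x; rewrite in_itv/= => /andP[x0 x1].
by rewrite ler_wpM2r ?sqrtr_ge0// exprS ler_piMl// exprn_ge0.
Qed.

(** By [semicircle_momentSS] the left side does not depend on n; its value is
read off at n = 0. *)
Lemma semicircle_moment_pair (R : realType) (n : nat) :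
  n.+1%:R * n.+2%:R * n.+3%:R *
    (semicircle_moment R 0 n * semicircle_moment R 0 n.+1) = pi / 2.
Proof.
have a1 : -1 <= (0 : R) < 1 by lra.
elim: n => [|n <-].
  have := semicircle_moment1 _ _ a1.
  rewrite expr0n/= subr0 sqrtr1 mul1r => h1.
  have := semicircle_moment_half_even R 0; rewrite catalan0 muln0 divr1 mulr1 => ->.
  have -> : semicircle_moment R 0 1 = 3^-1.
    by rewrite -[LHS](mulKf (_ : 3 != 0)) ?h1 ?mulr1 ?pnatr_eq0.
  by move: (pi : R) => p; field.
have := @semicircle_momentSS R 0 n a1.
rewrite expr0n mul0r => /(_ erefl) h.
rewrite (_ : _ * (_ * semicircle_moment R 0 n.+2) =
  n.+2%:R * n.+3%:R * semicircle_moment R 0 n.+1 *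
    (n.+4%:R * semicircle_moment R 0 n.+2)); last by ring.
by rewrite h; ring.
Qed.

(** The two hypotheses confine y between rational functions of n that are
1 + O(1/n). *)
Lemma dist_one_le (R : realType) (n y : R) : 0 <= n ->
  4 * n * (n + 1) <= (2 * n + 1) * (2 * n + 3) * y ->
  (2 * n + 1) ^+ 2 * (2 * n + 3) * y <= 8 * n * (n + 1) * (n + 2) ->
  `|y - 1| <= 2 / (n + 1).
Proof.
move=> n0 lo hi; rewrite ler_norml; apply/andP; split.
- rewrite -mulNr ler_pdivrMr; last lra.
  have D0 : 0 < (2 * n + 1) * (2 * n + 3) by nra.
  rewrite -(ler_pM2l D0); nra.
- rewrite ler_pdivlMr; last lra.
  have D0 : 0 < (2 * n + 1) ^+ 2 * (2 * n + 3) by nra.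
  rewrite -(ler_pM2l D0); nra.
Qed.

(** Let h_k be the half-semicircle moments and n = 2N.  The inequalities
h_(n+2) <= h_(n+1) <= h_n, where h_(n+2) is a multiple of h_n, bound h_n^2 below and above by multiples of
h_n h_(n+1), which [semicircle_moment_pair] evaluates, while
h_n = (pi/4) C_N / 4^N makes h_n^2 a multiple of pi^2 b_N^2 / 16^N. *)
Lemma wallis_dist_le (R : realType) (N : nat) :
  `|pi * (N%:R * 'C(2 * N, N)%:R ^+ 2 / 16 ^+ N) - 1| <= 2 * harmonic N :> R.
Proof.
pose h := semicircle_moment R 0.
have h_half := semicircle_moment_half_even R N.
have le1 : h (2 * N).+1 <= h (2 * N) by exact: semicircle_moment_le.
have le2 : h (2 * N).+2 <= h (2 * N).+1 by exact: semicircle_moment_le.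
have pair := semicircle_moment_pair R (2 * N).
have a1 : -1 <= (0 : R) < 1 by lra.
have := @semicircle_momentSS R 0 (2 * N) a1.
rewrite expr0n mul0r => /(_ erefl) rec.
have p0 := pi_gt0 R.
rewrite -/(h _) in h_half; rewrite -!/(h _) in pair rec.
have n0 : 0 <= N%:R :> R by [].
have -> : 2 * harmonic N = 2 / (N%:R + 1) :> R by rewrite /harmonic /= natr1.
pose x : R := 'C(2 * N, N)%:R ^+ 2 / 16 ^+ N.
have hx : h (2 * N) ^+ 2 = pi ^+ 2 * x / (16 * (N%:R + 1) ^+ 2).
  rewrite h_half /catalan /x natr1 (_ : 16 ^+ N = (4 ^+ N) ^+ 2); last first.
    by rewrite exprAC; congr (_ ^+ N); ring.
  move: (pi : R) => p; field.
  by rewrite nat1r expf_neq0 ?pnatr_eq0.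
have e1 : (2 * N).+1%:R = 2 * N%:R + 1 :> R by rewrite -natr1 natrM.
have e2 : (2 * N).+2%:R = 2 * N%:R + 2 :> R by rewrite -addn2 natrD natrM.
have e3 : (2 * N).+3%:R = 2 * N%:R + 3 :> R by rewrite -addn3 natrD natrM.
have e4 : (2 * N).+4%:R = 2 * N%:R + 4 :> R by rewrite -addn4 natrD natrM.
rewrite e1 e2 e3 in pair; rewrite e1 e4 in rec.
rewrite (_ : pi * _ = N%:R * (pi * x)); last by rewrite /x; move: (pi : R) => p; ring.
have h0 : 0 <= h (2 * N).
  by apply: Rintegral_ge0 => y; rewrite /= in_itv/= => /andP[y0 y1];
     rewrite mulr_ge0 ?exprn_ge0 ?sqrtr_ge0.
(* What remains is algebra in n = N, p = pi and the three consecutive moments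
   u >= v >= w. *)
move: (N%:R : R) (pi : R) (h (2 * N)) (h (2 * N).+1) (h (2 * N).+2)
  n0 p0 h0 le1 le2 pair rec hx => {h_half}.
move=> n p u v w n0 p0 u0 le1 le2 pair rec hx.
have d0 : 0 < (n + 1) by lra.
have hx' : 16 * (n + 1) ^+ 2 * u ^+ 2 = p ^+ 2 * x.
  by rewrite hx; field; rewrite gt_eqF.
apply: dist_one_le => //.
- rewrite mulrCA (_ : 4 * n * (n + 1) = n * (4 * (n + 1))); last by ring.
  apply: ler_wpM2l => //.
  have le : p / 2 <= (2 * n + 1) * (2 * n + 2) * (2 * n + 3) * u ^+ 2.
    by rewrite -pair expr2; apply: ler_wpM2l; [nra|exact: ler_wpM2l].
  have d1 : 0 < 8 * (n + 1) / p by rewrite divr_gt0//; lra.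
  have := ler_wpM2l (ltW d1) le.
  rewrite (_ : _ * (p / 2) = 4 * (n + 1)); last by field; rewrite gt_eqF.
  rewrite (_ : 8 * (n + 1) / p * ((2 * n + 1) * (2 * n + 2) * (2 * n + 3) * u ^+ 2) =
    (2 * n + 1) * (2 * n + 3) * (16 * (n + 1) ^+ 2 * u ^+ 2) / p); last first.
    by field; rewrite gt_eqF.
  rewrite hx' => /le_trans; apply; rewrite le_eqVlt; apply/predU1P; left.
  by field; rewrite gt_eqF.
- rewrite mulrCA (_ : 8 * n * _ * _ = n * (8 * (n + 1) * (n + 2))); last by ring.
  apply: ler_wpM2l => //.
  have le : (2 * n + 1) ^+ 2 * (2 * n + 2) * (2 * n + 3) * u ^+ 2
      <= (2 * n + 4) * (p / 2).
    rewrite -pair; pose c := (2 * n + 1) * (2 * n + 2) * (2 * n + 3) * u.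
    rewrite (_ : _ * u ^+ 2 = c * ((2 * n + 1) * u)); last by rewrite /c; ring.
    rewrite -rec [leRHS](_ : _ = c * ((2 * n + 4) * v)); last by rewrite /c; ring.
    apply: ler_wpM2l; last by apply: ler_wpM2l => //; lra.
    by rewrite /c mulr_ge0//; nra.
  have d1 : 0 < 8 * (n + 1) / p by rewrite divr_gt0//; lra.
  have := ler_wpM2l (ltW d1) le.
  rewrite (_ : _ * ((2 * n + 4) * _) = 8 * (n + 1) * (n + 2)); last first.
    by field; rewrite gt_eqF.
  apply: le_trans; rewrite [leRHS](_ : _ =
      (2 * n + 1) ^+ 2 * (2 * n + 3) * (16 * (n + 1) ^+ 2 * u ^+ 2) / p); last first.
    by field; rewrite gt_eqF.
  by rewrite hx' le_eqVlt; apply/predU1P; left; field; rewrite gt_eqF.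
Qed.

Lemma cvgn_ext (R : realType) (f g : nat -> R) (l : R) :
  f =1 g -> f @ \oo --> l -> g @ \oo --> l.
Proof. by move=> /funext ->. Qed.

Lemma wallis (R : realType) :
  (fun N => N%:R * 'C(2 * N, N)%:R ^+ 2 / 16 ^+ N : R) @ \oo --> pi^-1.
Proof.
have pi0 : (pi : R) != 0 by rewrite gt_eqF// pi_gt0.
have cvg1 : (fun N => pi * (N%:R * 'C(2 * N, N)%:R ^+ 2 / 16 ^+ N) : R) @ \oo --> (1 : R).
  have cvg0 : (fun N => 2 * harmonic N : R) @ \oo --> (0 : R).
    by rewrite -(mulr0 2); apply: cvgM; [exact: cvg_cst|exact: cvg_harmonic].
  apply: (@squeeze_cvgr _ _ _ _ (fun N => 1 - 2 * harmonic N)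
    (fun N => 1 + 2 * harmonic N)).
  - apply: nearW => N; have := wallis_dist_le R N; rewrite ler_norml => /andP[]; lra.
  - by rewrite -[X in _ --> X]subr0; apply: cvgB; first exact: cvg_cst.
  - by rewrite -[X in _ --> X]addr0; apply: cvgD; first exact: cvg_cst.
rewrite -[pi^-1]mulr1; apply: cvgn_ext (cvgM (cvg_cst (pi^-1 : R)) cvg1) => N /=.
by rewrite mulKf.
Qed.

(** * Summation of the series *)

(** Induction on j from Wallis' formula: the ratio of consecutive central
binomial coefficients tends to 4. *)
Lemma central_binomial_pair_cvg (R : realType) (j : nat) :
  (fun N => N%:R * ('C(2 * (j + N), j + N)%:R * 'C(2 * N, N)%:R) / 16 ^+ N : R) @ \oo
    --> 4 ^+ j / pi.
Proof.
elim: j => [|j IHj].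
  rewrite expr0 mul1r; apply: cvgn_ext (wallis R) => N.
  by rewrite add0n expr2.
have cvg4 : (fun N => 4 - 2 * harmonic (N + j)%N : R) @ \oo --> (4 : R).
  rewrite -[X in _ --> X]subr0 -[X in _ - X](mulr0 2).
  apply: cvgB; first exact: cvg_cst.
  apply: cvgM; first exact: cvg_cst.
  by have := @cvg_harmonic R; rewrite -(cvg_shiftn j).
rewrite exprS -mulrA; apply: cvgn_ext (cvgM cvg4 IHj) => N /=.
rewrite /harmonic /=.
have h := central_binomialS R (j + N).
have d0 : (j + N).+1%:R != 0 :> R by rewrite pnatr_eq0.
have -> : 'C(2 * (j.+1 + N), j.+1 + N)%:R =
    (4 - 2 / (N + j).+1%:R) * 'C(2 * (j + N), j + N)%:R :> R.
  apply: (mulfI d0); rewrite addSn h addnC mulrA; congr (_ * _).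
  by rewrite addnC -natr1 in d0 *; field.
by rewrite !mulrA; ring.
Qed.

(** The terms have ratio (k + j + 1/2)(k + 1/2) / ((k + j + 2)(k + 1)); the
lower parameter j + 2 exceeds the sum of the upper ones by exactly one, which is
the case where the partial sums of a 2F1 at 1 have a closed form. *)
Lemma catalan_central_binomial_series (R : realType) (j N : nat) :
  \sum_(0 <= k < N) catalan R (j + k) * 'C(2 * k, k)%:R / 16 ^+ k
  = 4 / (2 * j + 1)%:R *
    (N%:R * ('C(2 * (j + N), j + N)%:R * 'C(2 * N, N)%:R) / 16 ^+ N).
Proof.
elim: N => [|N IHN]; first by rewrite big_geq// !mul0r mulr0.
rewrite big_nat_recr//= IHN /catalan (addnS j N).
have h1 := central_binomialS R N; have h2 := central_binomialS R (j + N).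
have d0 : (j + N).+1%:R != 0 :> R by rewrite pnatr_eq0.
have d1 : (2 * j + 1)%:R != 0 :> R by rewrite pnatr_eq0 addn1.
have p16 : 16 ^+ N != 0 :> R by rewrite expf_neq0// pnatr_eq0.
rewrite [16 ^+ N.+1]exprS.
have -> : 'C(2 * (j + N).+1, (j + N).+1)%:R =
   (j + N).+1%:R^-1 * ((4 * (j + N)%:R + 2) * 'C(2 * (j + N), j + N)%:R) :> R.
  by rewrite -h2 mulKf.
rewrite (_ : N.+1%:R * (_ * _) =
  (j + N).+1%:R^-1 * ((4 * (j + N)%:R + 2) * 'C(2 * (j + N), j + N)%:R)
  * (N.+1%:R * 'C(2 * N.+1, N.+1)%:R)); last by ring.
rewrite h1.
have eN : (j + N)%:R = j%:R + N%:R :> R by rewrite natrD.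
rewrite -[(j + N).+1%:R]natr1 eN in d0 *; rewrite natrD natrM in d1 *.
move: (N%:R) (j%:R) (16 ^+ N) d0 d1 p16 => {IHN h1 h2} n i p d0 d1 p16.
by field; rewrite p16 d0 d1.
Qed.

Lemma catalan_central_binomial_series_cvg (R : realType) (j : nat) :
  series (fun k => catalan R (j + k) * 'C(2 * k, k)%:R / 16 ^+ k) @ \oo
    --> 4 / pi * (4 ^+ j / (2 * j + 1)%:R).
Proof.
rewrite (_ : _ * (_ / _) = 4 / (2 * j + 1)%:R * (4 ^+ j / pi)); last first.
  by move: (pi^-1 : R) => q; ring.
have cvg_pair := central_binomial_pair_cvg R j.
apply: cvgn_ext (cvgM (cvg_cst (4 / (2 * j + 1)%:R : R)) cvg_pair) => N /=.
by rewrite seriesEnat /= catalan_central_binomial_series.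
Qed.

Lemma half_cvgy : half @ \oo --> \oo.
Proof.
apply/cvgnyPge => n; exists (2 * n)%N => // m /=; lia.
Qed.

Lemma series_even_terms_cvg (R : realType) (u : nat -> R) (l : R) :
  (forall i, u (2 * i).+1%N = 0) ->
  series (fun i => u (2 * i)%N) @ \oo --> l -> series u @ \oo --> l.
Proof.
move=> u0; rewrite -cvg_shiftS => ul; rewrite -cvg_shiftS.
apply: cvgn_ext (cvg_comp half _ half_cvgy ul) => n /=.
by rewrite !seriesEnat /= [RHS](@sum_even_terms _ _ _ u0).
Qed.

Lemma series_odd_terms_cvg (R : realType) (u : nat -> R) (l : R) :
  (forall i, u (2 * i)%N = 0) ->
  series (fun i => u (2 * i).+1%N) @ \oo --> l -> series u @ \oo --> l.
Proof.
move=> u0 ul; rewrite -cvg_shiftS.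
have /= := @series_even_terms_cvg R (fun i => u i.+1) l _ ul.
move=> h; apply: cvgn_ext (h _) => [n|i]; last first.
  by rewrite -(u0 i.+1); congr u; lia.
by rewrite !seriesEnat /= big_nat_recl//= -(muln0 2) u0 add0r.
Qed.

(** The form in which vii states its limits. *)
Lemma limn_of_scaled_cvg (R : realType) (u : nat -> R) (c : R) :
  series u @ \oo --> 4 / pi * c ->
  cvgn (series u) /\ c = pi / 4 * limn (series u).
Proof.
move=> h; split; first by apply: cvgP h.
have /cvg_lim -> // := h.
have : (pi : R) != 0 by rewrite gt_eqF// pi_gt0.
by move: (pi : R) => p p0; field.
Qed.

Lemma catalan_dcoef_even_cvg (R : realType) (j : nat) :
  series (fun k => catalan R (j + k) / (4 ^+ k * (2 * k)`!%:R) * dcoef R (2 * k)) @ \oo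
    --> 4 / pi * (4 ^+ j / (2 * j + 1)%:R).
Proof.
have e16 k : 16 ^+ k = 4 ^+ k * 4 ^+ k :> R by rewrite -exprMn -natrM.
rewrite (_ : (fun _ => _) = fun k => catalan R (j + k) * 'C(2 * k, k)%:R / 16 ^+ k).
  exact: catalan_central_binomial_series_cvg.
apply/funext => k; rewrite dcoef_even e16; field.
by rewrite expf_neq0 ?pnatr_eq0// -lt0n fact_gt0.
Qed.

(** As d_(2k+1) carries the opposite sign, this is -1/2 times the even series for
j + 1. *)
Lemma catalan_dcoef_odd_cvg (R : realType) (j : nat) :
  series (fun k => catalan R (j + k + 1) / (2 ^+ (2 * k + 1) * (2 * k + 1)`!%:R)
    * dcoef R (2 * k + 1)) @ \oo
    --> 4 / pi * (- 2 * 2 ^+ (2 * j) / (2 * j + 3)%:R).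
Proof.
have e16 k : 16 ^+ k = 4 ^+ k * 4 ^+ k :> R by rewrite -exprMn -natrM.
have -> : 4 / pi * (- 2 * 2 ^+ (2 * j) / (2 * j + 3)%:R)
  = - 2^-1 * (4 / pi * (4 ^+ j.+1 / (2 * j.+1 + 1)%:R)) :> R.
  rewrite exprS -pow4E (_ : 2 * j.+1 + 1 = 2 * j + 3)%N; last lia.
  by move: (pi^-1 : R) ((2 * j + 3)%:R^-1 : R) => q r; field.
have h := catalan_central_binomial_series_cvg R j.+1.
apply: cvgn_ext (cvgM (cvg_cst (- 2^-1 : R)) h) => N /=.
rewrite !seriesEnat /= mulr_sumr; apply: eq_bigr => k _.
rewrite !addn1 dcoef_odd e16 addSn exprS -pow4E; field.
by rewrite expf_neq0 ?pnatr_eq0// -lt0n fact_gt0.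
Qed.

(** The odd semicircle moments vanish, so only the k with the parity of n remain,
and the series is the even or the odd one for the floor of n/2. *)
Lemma moment_linear_series_cvg (R : realType) (n : nat) :
  series (fun k => moment (3 / 2 : R) (3 / 2) (n + k) / (2 ^+ k * k`!%:R) * dcoef R k)
    @ \oo --> 4 / pi * moment (1 : R) 2 n.
Proof.
set u := (fun k : nat => _).
have [on|en] := boolP (odd n).
- have En : n = (2 * n./2).+1 by lia.
  rewrite En moment_linear_odd; apply: series_odd_terms_cvg => [i|].
    rewrite /u En (_ : _ + _ = (2 * (n./2 + i)).+1)%N; last lia.
    by rewrite moment_semicircle_odd !mul0r.
  apply: cvgn_ext (catalan_dcoef_odd_cvg R n./2) => N.
  rewrite !seriesEnat /=; apply: eq_bigr => k _.
  rewrite /u En -moment_semicircle_even !addn1.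
  by congr (moment _ _ _ / _ * _); lia.
- have En : n = (2 * n./2)%N by lia.
  rewrite En moment_linear_even; apply: series_even_terms_cvg => [i|].
    rewrite /u En (_ : _ + _ = (2 * (n./2 + i)).+1)%N; last lia.
    by rewrite moment_semicircle_odd !mul0r.
  apply: cvgn_ext (catalan_dcoef_even_cvg R n./2) => N.
  rewrite !seriesEnat /=; apply: eq_bigr => k _.
  by rewrite /u -moment_semicircle_even pow4E mulnDr -En.
Qed.

Theorem theorem3 (R : realType) :
  (* i *)
  (forall n : nat,
     \sum_(0 <= i < n./2.+1)
        'C(n, 2 * i)%:R * 2 ^+ (n - 2 * i) * 'C(2 * i, i)%:R
     = 'C(2 * n, n)%:R :> R) /\
  (* ii *)
  (forall n : nat, (1 <= n)%N ->
     'C(2 * n, n)%:R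
     = 2 * 4 ^+ (n - 1)
       - 2 ^+ (n - 1) *
         \sum_(1 <= j < n./2.+1)
            'C(n, 2 * j)%:R * \sum_(0 <= s < j) catalan R s / 4 ^+ s :> R) /\
  (* iii *)
  (forall n : nat,
     catalan R n.+1
     = 2 * 'C(2 * n, n)%:R
       - 1 / 2 *
         \sum_(0 <= j < n./2.+1)
            'C(n, 2 * j)%:R * 2 ^+ (n - 2 * j) * 'C(2 * j + 2, j + 1)%:R) /\
  (* iv *)
  (forall n : nat,
     catalan R n
     = \sum_(0 <= k < n.+1)
          (-1) ^+ k * 'C(n, k)%:R * 'C(k, k./2)%:R * 2 ^+ (n - k)) /\
  (* v: floor((n - 1) / 2) + 1 = floor((n + 1) / 2), so 0 terms when n = 0 *)
  (forall n : nat,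
     1 / 2 ^ (n%:Z - 1) * 'C(n, n./2)%:R
     = 2 - \sum_(0 <= j < n.+1./2) 1 / 4 ^+ j * catalan R j :> R) /\
  (* vi *)
  (forall n : nat,
     moment (3 / 2 : R) (3 / 2) n
     = 2 * 'C(n, n./2)%:R - 'C(n.+1, n.+1./2)%:R) /\
  (* vii *)
  dcoef R 0 = 1 /\
  (forall n : nat,
     let u := fun k : nat =>
       moment (3 / 2 : R) (3 / 2) (n + k) / (2 ^+ k * k`!%:R) * dcoef R k in
     cvgn (series u) /\
     moment (1 : R) 2 n = pi / 4 * limn (series u)) /\
  (forall j : nat,
     let u := fun k : nat =>
       catalan R (j + k + 1) / (2 ^+ (2 * k + 1) * (2 * k + 1)`!%:R)
       * dcoef R (2 * k + 1) in
     cvgn (series u) /\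
     - 2 * 2 ^+ (2 * j) / (2 * j + 3)%:R = pi / 4 * limn (series u)) /\
  (forall j : nat,
     let u := fun k : nat =>
       catalan R (j + k) / (4 ^+ k * (2 * k)`!%:R) * dcoef R (2 * k) in
     cvgn (series u) /\
     4 ^+ j / (2 * j + 1)%:R = pi / 4 * limn (series u)).
Proof.
split; first exact: central_binomial_sum.
split; first exact: central_binomial_catalan_sum.
split; first exact: catalanS_central_binomial_sum.
split; first by move=> n; rewrite catalanE middle_binomial_alternating_sum.
split.
  move=> n; have p2 : (2 : R) ^ (n%:Z - 1) = 2 ^+ n / 2.
    by rewrite expfzDr ?pnatr_eq0.
  rewrite p2 div1r invf_div mulrAC middle_binomial_catalan_series.
  by congr (_ - _); apply: eq_bigr => j _; rewrite mulrC div1r.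
split; first exact: moment_semicircle_middle_binomials.
split; first by rewrite (dcoef_even R 0) bin0 expr0 divr1 mulr1.
split; first by move=> n u; apply: limn_of_scaled_cvg; exact: moment_linear_series_cvg.
split=> j u; apply: limn_of_scaled_cvg; first exact: catalan_dcoef_odd_cvg.
exact: catalan_dcoef_even_cvg.
Qed.
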